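(* Let $n\geq 1$ be an integer, $\mu\in\mathbb{R}$ and $\vec{B}=(B_1,\dots,B_n)\in\mathcal{B}_n(\mu)$. Set $b_1=B_1-\mu$ and $b_k=B_k-B_{k-1}$ for $2\leq k\leq n$. Then the following two conditions are equivalent: (i) $b_k>b_{k-2}$ for all $k$ with $3\leq k\leq n$; (ii) $\vec{A}\preceq\vec{B}$ for every $\vec{A}\in\mathcal{B}_n(\mu)$ such that $\vec{A}<\vec{B}$.
   Context: For an integer $n\ge 1$ and $\mu\in\mathbb{R}$, a distribution of $n$ beads on $[\mu,\infty)$ is a vector $\vec{A}=(A_1,\dots,A_n)\in\mathbb{R}^n$ with $\mu\leq A_1<A_2<\cdots<A_n$. It is called monotone if $A_1-\mu\leq A_2-A_1\leq\cdots\leq A_n-A_{n-1}$. The set of monotone distributions of $n$ beads on $[\mu,\infty)$ is denoted $\mathcal{B}_n(\mu)$. For $\vec{A},\vec{B}\in\mathcal{B}_n(\mu)$, $\vec{A}\leq\vec{B}$ means $A_k\leq B_k$ for all $k=1,\dots,n$, and $\vec{A}<\vec{B}$ means $\vec{A}\leq\vec{B}$ and $\vec{A}\neq\vec{B}$. Let $e_1,\dots,e_n$ be the canonical basis of $\mathbb{R}^n$. An admissible bead slide applied to $\vec{A}\in\mathcal{B}_n(\mu)$ is a transformation $\vec{A}\mapsto\vec{A}'=\vec{A}+\delta e_k$ with $\delta\geq 0$, $1\leq k\leq n$ and $\vec{A}'\in\mathcal{B}_n(\mu)$. One writes $\vec{A}\preceq\vec{B}$ if $\vec{B}$ can be obtained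 from $\vec{A}$ by a finite sequence of admissible bead slides. *)

(* Defs.v *)
From Stdlib Require Import Relation_Operators.
From mathcomp Require Import all_boot all_order all_algebra.
From mathcomp Require Import reals.

Set Implicit Arguments.
Unset Strict Implicit.
Unset Printing Implicit Defensive.

Import Order.TTheory GRing.Theory Num.Theory.
Local Open Scope ring_scope.

(* Beads are indexed from 0: the k-th bead A_k, 1 <= k <= n, of a distribution
   A : 'rV[R]_n is [A 0 i] with [i : 'I_n] of value k - 1. *)

(* The gap in front of a bead: A_1 - mu for the first one, A_k - A_(k-1) for
   the others. [ord_pred] is cyclic, but is only used here at [k != 0], where
   it is the usual predecessor. *)
Definition gap (R : realType) (n : nat) (mu : R) (A : 'rV[R]_n) (k : 'I_n) : R :=
  A 0 k - (if k == 0%N :> nat then mu else A 0 (ord_pred k)).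

Definition bead_distribution (R : realType) (n : nat) (mu : R)
    (A : 'rV[R]_n) : Prop :=
  (forall i : 'I_n, i = 0%N :> nat -> mu <= A 0 i) /\
  (forall i j : 'I_n, j = i.+1 :> nat -> A 0 i < A 0 j).

(* Membership in B_n(mu). *)
Definition monotone_beads (R : realType) (n : nat) (mu : R)
    (A : 'rV[R]_n) : Prop :=
  bead_distribution mu A /\
  (forall i j : 'I_n, j = i.+1 :> nat -> gap mu A i <= gap mu A j).

Definition beads_le (R : realType) (n : nat) (A B : 'rV[R]_n) : Prop :=
  forall k : 'I_n, A 0 k <= B 0 k.

Definition beads_lt (R : realType) (n : nat) (A B : 'rV[R]_n) : Prop :=
  beads_le A B /\ A <> B.

(* [delta_mx 0 k] is the canonical basis vector e_k. *)
Definition admissible_slide (R : realType) (n : nat) (mu : R)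
    (A A' : 'rV[R]_n) : Prop :=
  [/\ monotone_beads mu A, monotone_beads mu A'
    & exists (d : R) (k : 'I_n), 0 <= d /\ A' = A + d *: delta_mx 0 k].

Definition slides_to (R : realType) (n : nat) (mu : R) : 'rV[R]_n -> 'rV[R]_n -> Prop :=
  clos_refl_trans _ (@admissible_slide R n mu).

(* Main.v *)
Require Import Defs.
From Stdlib Require Import Relation_Operators.
From mathcomp Require Import all_boot all_order all_algebra.
From mathcomp Require Import reals ring lra zify.

Set Implicit Arguments.
Unset Strict Implicit.
Unset Printing Implicit Defensive.

Import Order.TTheory GRing.Theory Num.Theory.
Local Open Scope ring_scope.

(** Prefix a distribution with the fixed value [mu]: the resulting function on
    {0, ..., n} (n beads) is its profile, and monotone gaps mean that the
    profile is convex at 1, ..., n-1.  Raising the value at one point can only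
    break convexity at that point, since it helps at the two neighbours; so a
    bead may be raised up to the average of its neighbours, and the last bead
    freely.  Hence ([relaxation]) all beads can be raised one after the other,
    each up to the average of the old positions of its neighbours.

    Suppose that no three consecutive gaps of B are equal, and A <= B.  The
    distributions max(A, B - s q), with q a positive concave parabola, lead
    from A (s large) to B (s = 0).  Since q exceeds the average of its two
    neighbours by a fixed amount, relaxation leads from one value of s to any
    slightly smaller one, the admissible decrease being proportional to s; the
    sequence s = S / t meets this condition, so A slides as close to B as
    desired ([slides_to_envelope]).  Two more relaxations end exactly at B
    ([slides_to_isolated_flats]): once close enough, the beads where B is
    strictly convex can be put in place; a bead where B is flat (its two gaps
    are equal) has by hypothesis no flat neighbour, so its neighbours are then
    in place and their average is its final position.

    Conversely, let B have three equal gaps, between beads p, p+1, p+2 and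
    p+3.  If A <= B agrees with B at p+3 and lies strictly below at p+1 and
    p+2, then A does not slide to B: a convex function below B that agrees
    with B at p+3 and at one of p+1, p+2 agrees with the affine piece of B at
    both, and a single slide cannot put two beads in place
    ([equal_gaps_block_slides]).  Such an A exists when the triple is the last
    one ([monotone_below_equal_gaps]). *)

(** * Distributions as convex functions *)

(** The value at 0 is the wall [mu]; bead number k (counted from 1) has
    value k. *)
Definition profile (R : realType) (n : nat) (mu : R) (A : 'rV[R]_n.+1)
    (k : nat) : R :=
  if k is j.+1 then A 0 (inord j) else mu.

Definition beads_of (R : realType) (n : nat) (f : nat -> R) : 'rV[R]_n.+1 :=
  \row_(i < n.+1) f i.+1.

Definition convex_upto (R : realType) (n : nat) (f : nat -> R) : Prop :=
  forall k, (k < n)%N -> 2 * f k.+1 <= f k + f k.+2.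

Lemma profile_ord (R : realType) n (mu : R) (A : 'rV[R]_n.+1) (i : 'I_n.+1) :
  profile mu A i.+1 = A 0 i.
Proof. by rewrite /= inord_val. Qed.

Lemma profile_beads_of (R : realType) n (mu : R) f k :
  f 0%N = mu -> (k <= n.+1)%N -> profile mu (beads_of n f) k = f k.
Proof. by case: k => [|k] //= _ hk; rewrite mxE inordK. Qed.

Lemma gap_profile (R : realType) n (mu : R) (A : 'rV[R]_n.+1) (i : 'I_n.+1) :
  gap mu A i = profile mu A i.+1 - profile mu A i.
Proof.
rewrite /gap profile_ord; congr (_ - _).
case: i => [[|j] hj] //=; congr (A 0 _).
by apply: val_inj; rewrite /= inordK ?modnDr ?modn_small //; lia.
Qed.

(** Here and below there are n+1 beads, so that the convexity constraints sit at
    the points 1, ..., n and the last bead n+1 is unconstrained. *)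
Lemma monotone_beadsP (R : realType) n (mu : R) (A : 'rV[R]_n.+1) :
  monotone_beads mu A <->
  [/\ mu <= profile mu A 1,
      forall k, (k < n)%N -> profile mu A k.+1 < profile mu A k.+2
    & convex_upto n (profile mu A)].
Proof.
split=> [[[h1 h2] h3]|[h1 h2 h3]].
- split=> [|k kn|k kn].
  + by apply: h1; rewrite inordK.
  + by apply: h2; rewrite !inordK //; lia.
  + have := h3 (inord k) (inord k.+1).
    rewrite !gap_profile !inordK; [|lia..].
    by move=> /(_ erefl) h; lra.
- split; [split|] => [i hi|i j hij|i j hij].
  + by rewrite -(profile_ord mu) hi.
  + by rewrite -!(profile_ord mu) hij; apply: h2; have := ltn_ord j; lia.
  + rewrite !gap_profile hij.
    have := h3 i; have -> : (i < n)%N by have := ltn_ord j; lia.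
    by move=> /(_ isT) h; lra.
Qed.

Lemma profile_le (R : realType) n (mu : R) (A B : 'rV[R]_n.+1) k :
  beads_le A B -> profile mu A k <= profile mu B k.
Proof. by case: k => [|k] /= h. Qed.

Lemma profile_increasing (R : realType) n (mu : R) (A : 'rV[R]_n.+1) k :
  monotone_beads mu A -> (k <= n)%N -> profile mu A k <= profile mu A k.+1.
Proof.
move=> /monotone_beadsP[h1 h2 _]; case: k => [|k] kn //.
exact/ltW/h2.
Qed.

(** A convex profile starting with a positive gap is strictly increasing.  If
    instead the first bead of C is at [mu], so is that of A, and the second one
    is then pushed off [mu] by the second bead of A. *)
Lemma monotone_above (R : realType) n (mu : R) (A C : 'rV[R]_n.+1) :
  monotone_beads mu A -> beads_le A C -> convex_upto n (profile mu C) ->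
  monotone_beads mu C.
Proof.
move=> /monotone_beadsP[a1 a2 _] AC convC; apply/monotone_beadsP.
have le k := profile_le mu k AC.
split=> //; first exact: le_trans a1 (le 1%N).
elim=> [|k IH] kn; last first.
  by have := IH (ltnW kn); have := convC k.+1 kn; lra.
have := convC 0%N kn; have := le 2%N; have := le 1%N; have := a2 0%N kn.
rewrite [profile mu C 0%N]/= => *.
have [?|?] := ltP mu (profile mu C 1); lra.
Qed.

(** * Slides *)

Lemma slide_le (R : realType) n (mu : R) (A B : 'rV[R]_n) :
  admissible_slide mu A B -> beads_le A B.
Proof.
move=> [_ _ [d [k [d0 ->]]]] i.
by rewrite !mxE eqxx /= lerDl mulr_ge0 // ler0n.
Qed.

Lemma slide_moves_one_bead (R : realType) n (mu : R) (A B : 'rV[R]_n)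
    (i j : 'I_n) :
  admissible_slide mu A B -> i != j -> B 0 i = A 0 i \/ B 0 j = A 0 j.
Proof.
move=> [_ _ [d [k [d0 ->]]]] ij; rewrite !mxE eqxx /=.
have [ik|_] := eqVneq i k; last by left; rewrite mulr0 addr0.
by right; rewrite -ik eq_sym (negPf ij) mulr0 addr0.
Qed.

(** Beads are moved from the first to the last.  The distributions on the way
    mix old and new positions, and they stay convex: the hypothesis bounds a
    new position by the old positions of its neighbours, which only
    increase. *)
Lemma relaxation (R : realType) n (mu : R) (C D : 'rV[R]_n.+1) :
  monotone_beads mu C -> beads_le C D ->
  (forall k, (k < n)%N ->
     2 * profile mu D k.+1 <= profile mu C k + profile mu C k.+2) ->
  monotone_beads mu D /\ slides_to mu C D.
Proof.
move=> mC CD hD.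
have [_ _ convC] := (monotone_beadsP mu C).1 mC.
pose M j : 'rV[R]_n.+1 := \row_i (if (i < j)%N then D 0 i else C 0 i).
have CM j : beads_le C (M j) by move=> i; rewrite mxE; case: ifP.
have mM j : monotone_beads mu (M j).
  apply: (monotone_above mC (CM j)) => k kn.
  have := profile_le mu k (CM j); have := profile_le mu k.+2 (CM j).
  have : profile mu (M j) k.+1 = profile mu D k.+1 \/
         profile mu (M j) k.+1 = profile mu C k.+1.
    by rewrite /= mxE; case: ifP; [left|right].
  have := hD k kn; have := convC k kn.
  by move=> ? ? [] ->; lra.
have M0 : M 0%N = C by apply/rowP => i; rewrite mxE.
have Mn : M n.+1 = D by apply/rowP => i; rewrite mxE ltn_ord.
have slides_M j : (j <= n.+1)%N -> slides_to mu C (M j); last first.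
  by rewrite -Mn; split=> //; exact: slides_M.
elim: j => [|j IH] jn; first by rewrite M0; exact: rt_refl.
apply: rt_trans (IH (ltnW jn)) _; apply: rt_step; split=> //.
pose i := Ordinal jn; exists (D 0 i - C 0 i), i.
split; first by rewrite subr_ge0.
apply/rowP => l; rewrite !mxE eqxx /= ltnS leq_eqVlt.
have [->|li] := eqVneq l i.
  by rewrite /= eqxx ltnn /= mulr1 addrC subrK.
have -> : (l == j :> nat) = false by apply/negbTE.
by rewrite mulr0 addr0.
Qed.

(** * Reaching a distribution without three equal consecutive gaps *)

(** A function on {0, ..., n+1} that is at least 1 and exceeds the average of
    its two neighbours by 1 at each point. *)
Definition parabola (R : realType) (n k : nat) : R :=
  (n.+1 ^ 2).+1%:R - (k ^ 2)%:R.

Lemma parabola_bounds (R : realType) n k : (k <= n.+1)%N ->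
  1 <= parabola R n k <= (n.+1 ^ 2).+1%:R.
Proof.
move=> kn; have h : (k ^ 2 <= n.+1 ^ 2)%N by rewrite leq_exp2r.
rewrite /parabola; apply/andP; split; last by rewrite gerBl ler0n.
by rewrite -natr1; move: h; rewrite -(ler_nat R); lra.
Qed.

Lemma parabola_average (R : realType) n k :
  parabola R n k + parabola R n k.+2 = 2 * (parabola R n k.+1 - 1).
Proof. by rewrite /parabola !natrX -!natr1; ring. Qed.

(** The maximum of A and a lowered copy of B: it is A for s large, as the
    parabola is at least 1, and B for s = 0.  The profile at 0 stays [mu]
    because the parabola is positive there. *)
Definition envelope (R : realType) n (mu : R) (A B : 'rV[R]_n.+1) (s : R) :
    'rV[R]_n.+1 :=
  beads_of n (fun k =>
    Num.max (profile mu A k) (profile mu B k - s * parabola R n k)).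

Lemma profile_envelope (R : realType) n (mu : R) (A B : 'rV[R]_n.+1) (s : R) k :
  0 <= s -> (k <= n.+1)%N ->
  profile mu (envelope mu A B s) k =
    Num.max (profile mu A k) (profile mu B k - s * parabola R n k).
Proof.
move=> s0 kn; apply: profile_beads_of => //=.
apply/max_idPl; rewrite gerBl mulr_ge0 //.
by case/andP: (@parabola_bounds R n 0 isT); lra.
Qed.

(** A bead that is at its position in A obeys the relaxation bound by convexity
    of A.  Otherwise it is on B minus s' times the parabola q: lowering B by
    s q gains s on the average of the neighbours, which pays for
    the rise (s - s') q. *)
Lemma envelope_step (R : realType) n (mu : R) (A B : 'rV[R]_n.+1) (s s' : R) :
  monotone_beads mu A -> monotone_beads mu B ->
  0 <= s' <= s -> (s - s') * (n.+1 ^ 2).+1%:R <= s ->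
  monotone_beads mu (envelope mu A B s) ->
  monotone_beads mu (envelope mu A B s') /\
  slides_to mu (envelope mu A B s) (envelope mu A B s').
Proof.
move=> mA mB /andP[s'0 s's] hs mC; have s0 := le_trans s'0 s's.
have [_ _ convA] := (monotone_beadsP mu A).1 mA.
have [_ _ convB] := (monotone_beadsP mu B).1 mB.
apply: relaxation => // [i|k kn].
  rewrite !mxE.
  have /parabola_bounds-/(_ R)/andP[p1 _] : (i.+1 <= n.+1)%N by [].
  have p0 : 0 <= parabola R n i.+1 by lra.
  have := ler_wpM2r p0 s's.
  by rewrite ge_max !le_max lexx /= => ?; apply/orP; right; lra.
have ge_AB j : (j <= n.+1)%N ->
    profile mu A j <= profile mu (envelope mu A B s) j /\
    profile mu B j - s * parabola R n j <= profile mu (envelope mu A B s) j.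
  by move=> jn; rewrite profile_envelope // !le_max !lexx orbT; split.
have [a0 b0] := ge_AB k ltac:(lia); have [a2 b2] := ge_AB k.+2 ltac:(lia).
rewrite (profile_envelope _ _ _ s'0); last lia.
rewrite maxr_pMr // ge_max; apply/andP; split; first by have := convA k kn; lra.
have /parabola_bounds-/(_ R)/andP[_ pK] : (k.+1 <= n.+1)%N by lia.
have h : (s - s') * parabola R n k.+1 <= s.
  by apply: le_trans hs; rewrite ler_wpM2l // subr_ge0.
have := convB k kn.
have : s * parabola R n k + s * parabola R n k.+2 =
       2 * (s * parabola R n k.+1) - 2 * s.
  by rewrite -mulrDr parabola_average; ring.
by lra.
Qed.

Lemma envelope_start (R : realType) n (mu : R) (A B : 'rV[R]_n.+1) (s : R) :
  (forall i, B 0 i - A 0 i <= s) -> 0 <= s -> envelope mu A B s = A.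
Proof.
move=> hs s0; apply/rowP => i; rewrite mxE !profile_ord.
apply/max_idPl; have := hs i.
have /parabola_bounds-/(_ R)/andP[p1 _] : (i.+1 <= n.+1)%N by [].
have := ler_wpM2l s0 p1; lra.
Qed.

(** The parameters S / t for t >= K, with K an upper bound of the parabola: the
    decrease from S / t to S / (t + 1) is the fraction 1 / (t + 1) of S / t,
    hence allowed by [envelope_step]. *)
Lemma slides_to_envelope (R : realType) n (mu : R) (A B : 'rV[R]_n.+1) :
  monotone_beads mu A -> monotone_beads mu B -> beads_le A B ->
  exists2 S : R, 0 <= S & forall t : nat,
    let C := envelope mu A B (S / ((n.+1 ^ 2).+1 + t)%:R) in
    monotone_beads mu C /\ slides_to mu A C.
Proof.
move=> mA mB AB; set K := (n.+1 ^ 2).+1.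
pose s := \sum_i (B 0 i - A 0 i).
have s0 : 0 <= s by apply: sumr_ge0 => i _; rewrite subr_ge0.
have K0 : (0 : R) < K%:R by rewrite ltr0n.
exists (s * K%:R) => [|t /=]; first by rewrite mulr_ge0.
elim: t => [|t [mC AC]].
  rewrite addn0 mulfK ?gt_eqF // envelope_start //.
    by split=> //; exact: rt_refl.
  move=> i; rewrite /s (bigD1 i) //= lerDl sumr_ge0 // => j _.
  by rewrite subr_ge0.
suff [mD CD] : monotone_beads mu (envelope mu A B (s * K%:R / (K + t.+1)%:R)) /\
    slides_to mu (envelope mu A B (s * K%:R / (K + t)%:R))
      (envelope mu A B (s * K%:R / (K + t.+1)%:R)).
  by split=> //; apply: rt_trans AC CD.
have S0 : 0 <= s * K%:R by rewrite mulr_ge0.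
move: (s * K%:R) S0 mC {AC} => S S0 mC.
have T0 : (0 : R) < (K + t)%:R by rewrite ltr0n.
have KT : (K%:R : R) <= (K + t)%:R by rewrite ler_nat leq_addr.
have T1 : ((K + t.+1)%:R : R) = (K + t)%:R + 1 by rewrite addnS -natr1.
rewrite T1; move: (K + t)%:R T0 KT mC {T1} => T T0 KT mC.
have T1 : 0 < T + 1 by lra.
have q0 : 0 <= S / (T + 1) by rewrite divr_ge0 // ltW.
have q1 : S / T = S / (T + 1) + S / (T + 1) / T by field; rewrite !gt_eqF.
have q2 : S / T - S / (T + 1) = S / (T + 1) / T by rewrite q1; ring.
apply: envelope_step => //.
  by rewrite q0 q1 lerDl divr_ge0 // ltW.
rewrite q2 -[leRHS](_ : S / (T + 1) / T * (T + 1) = _); last first.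
  by field; rewrite !gt_eqF.
apply: ler_wpM2l; last by rewrite -/K; lra.
by rewrite divr_ge0 // ltW.
Qed.

(** A first relaxation puts the beads where B is strictly convex in place (this
    is where C has to be close to B), and a second one the remaining beads,
    whose neighbours have all reached B. *)
Lemma slides_to_isolated_flats (R : realType) n (mu : R) (B C : 'rV[R]_n.+1) :
  monotone_beads mu C -> beads_le C B ->
  let b := profile mu B in
  (forall k, (k < n)%N -> 2 * b k.+1 < b k + b k.+2 ->
    2 * b k.+1 <= profile mu C k + profile mu C k.+2) ->
  (forall k, (k.+1 < n)%N -> 2 * b k.+1 = b k + b k.+2 ->
    2 * b k.+2 < b k.+1 + b k.+3) ->
  monotone_beads mu B -> slides_to mu C B.
Proof.
move=> mC CB b near isolated mB.
have [_ _ convB] := (monotone_beadsP mu B).1 mB.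
have [_ _ convC] := (monotone_beadsP mu C).1 mC.
pose flat k := (0 < k <= n)%N && (2 * b k == b k.-1 + b k.+1).
pose D := beads_of n (fun k => if flat k then profile mu C k else b k).
have DE k : (k <= n.+1)%N ->
    profile mu D k = if flat k then profile mu C k else b k.
  exact: profile_beads_of.
have CD : beads_le C D.
  move=> i; rewrite -!(profile_ord mu) DE //; case: ifP => // _.
  exact: profile_le.
have DB : beads_le D B.
  move=> i; rewrite -!(profile_ord mu) DE //; case: ifP => // _.
  exact: profile_le.
have strict k : (k < n)%N -> ~~ flat k.+1 -> 2 * b k.+1 < b k + b k.+2.
  by move=> kn; rewrite /flat kn /= lt_neqAle => -> /=; apply: convB.
have [mD sCD] : monotone_beads mu D /\ slides_to mu C D.
  apply: relaxation => // k kn; rewrite DE; last lia.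
  case: ifPn => [_|/(strict k kn)]; first exact: convC.
  exact: near.
apply: rt_trans sCD _; apply: (proj2 (relaxation mD DB _)) => k kn.
have [/andP[_ /eqP e]|/(strict k kn) ns] := boolP (flat k.+1); last first.
  have := near k kn ns; have := profile_le mu k CD.
  by have := profile_le mu k.+2 CD; rewrite -/b; lra.
rewrite /= in e; rewrite -/b e !DE; try lia.
have -> : flat k = false.
  case: k kn e => // k kn e; apply/negP => /andP[_ /eqP /= e'].
  by have := isolated k kn e'; rewrite e ltxx.
suff -> : flat k.+2 = false by [].
apply/negP => /andP[/= k2n /eqP e'].
by have := isolated k k2n e; rewrite e' ltxx.
Qed.

Lemma slides_to_no_equal_gaps (R : realType) n (mu : R) (A B : 'rV[R]_n.+1) :
  monotone_beads mu A -> monotone_beads mu B -> beads_le A B ->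
  (forall j k : 'I_n.+1, k = j.+2 :> nat -> gap mu B j < gap mu B k) ->
  slides_to mu A B.
Proof.
move=> mA mB AB hB; set b := profile mu B.
have [S S0 near] := slides_to_envelope mA mB AB.
pose margin k := b k + b k.+2 - 2 * b k.+1.
set K := (n.+1 ^ 2).+1 in near.
(* The t-th envelope is within S K / (K + t) of B; t makes this at most half
   of every positive convexity margin of B. *)
pose t := (\max_(k < n) Num.bound (2 * S * K%:R / margin k))%N.
have [mC AC] := near t; set C := envelope _ _ _ _ in mC AC.
have T0 : (0 : R) < (K + t)%:R by rewrite ltr0n.
have s0 : 0 <= S / (K + t)%:R by rewrite divr_ge0 // ltW.
apply: rt_trans AC _; apply: slides_to_isolated_flats => //.
- move=> i; rewrite mxE ge_max !profile_ord AB gerBl mulr_ge0 //.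
  have /parabola_bounds-/(_ R)/andP[p1 _] : (i.+1 <= n.+1)%N by [].
  by lra.
- move=> k kn; rewrite -/b => strict.
  have m0 : 0 < margin k by rewrite /margin; lra.
  have small : 2 * (S / (K + t)%:R * K%:R) <= margin k.
    have -> : 2 * (S / (K + t)%:R * K%:R) = 2 * S * K%:R / (K + t)%:R by ring.
    rewrite ler_pdivrMr // [margin k * _]mulrC -ler_pdivrMr //.
    have q0 : 0 <= 2 * S * K%:R / margin k.
      by rewrite divr_ge0 ?(ltW m0) ?mulr_ge0.
    apply: le_trans (ltW (archi_boundP q0)) _.
    rewrite ler_nat; apply: leq_trans (leq_addl _ _).
    exact: (leq_bigmax (Ordinal kn)).
  have ge_b j : (j <= n.+1)%N -> b j - S / (K + t)%:R * K%:R <= profile mu C j.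
    move=> jn; rewrite profile_envelope // le_max; apply/orP; right.
    by rewrite lerB // ler_wpM2l //; case/andP: (parabola_bounds R jn).
  have := ge_b k ltac:(lia); have := ge_b k.+2 ltac:(lia).
  by move: small; rewrite /margin; lra.
- move=> k kn e; have := hB (inord k) (inord k.+2).
  rewrite !gap_profile !inordK; [|lia..].
  by move=> /(_ erefl); move: e; rewrite /=; lra.
Qed.

(** * Three equal consecutive gaps *)

(** The invariant along slides: bead p+3 is in place, and as long as B is not
    overtaken, both p+1 and p+2 are strictly below B.  One of p+1, p+2 does not
    move in a slide, and convexity on p, ..., p+3, where B is affine, prevents
    the other one from getting in place alone.  Only the first and the third
    gap are assumed equal, since monotonicity squeezes the second one. *)
Lemma equal_gaps_block_slides (R : realType) n (mu : R) (A B : 'rV[R]_n.+1) p :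
  (p.+3 <= n.+1)%N ->
  profile mu B p.+3 - profile mu B p.+2 = profile mu B p.+1 - profile mu B p ->
  monotone_beads mu B ->
  profile mu A p.+3 = profile mu B p.+3 ->
  profile mu A p.+1 < profile mu B p.+1 ->
  profile mu A p.+2 < profile mu B p.+2 ->
  ~ slides_to mu A B.
Proof.
move=> pn e mB A3 A1 A2 AB.
have [_ _ convB] := (monotone_beadsP mu B).1 mB.
pose inv (C : 'rV[R]_n.+1) := profile mu B p.+3 <= profile mu C p.+3 /\
  (beads_le C B -> profile mu C p.+1 < profile mu B p.+1 /\
     profile mu C p.+2 < profile mu B p.+2).
suff inv_slides C D : slides_to mu C D -> inv C -> inv D.
  have [] : inv B by apply: inv_slides AB _; split=> //; rewrite A3.
  by move=> _ /(_ (fun=> lexx _))[]; rewrite ltxx.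
elim=> {C D} // [C D CD [C3 inv12]|C D E _ IH1 _ IH2 /IH1/IH2 //].
have leCD := slide_le CD.
split=> [|leDB]; first exact: le_trans C3 (profile_le _ _ leCD).
have [C1 C2] := inv12 (fun i => le_trans (leCD i) (leDB i)).
have [_ /monotone_beadsP[_ _ convD] _] := CD.
have D3 := le_trans C3 (profile_le mu p.+3 leCD).
have := convD p ltac:(lia); have := convD p.+1 ltac:(lia).
have := convB p ltac:(lia); have := convB p.+1 ltac:(lia).
have := profile_le mu p leDB; have := profile_le mu p.+1 leDB.
have := profile_le mu p.+2 leDB; have := profile_le mu p.+3 leDB.
have : profile mu D p.+1 = profile mu C p.+1 \/
       profile mu D p.+2 = profile mu C p.+2.
  apply: slide_moves_one_bead CD _; rewrite -val_eqE /= !inordK; lia.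
by case=> [E|E] *; rewrite E; split; lra.
Qed.

(** Shrink the first p+2 beads slightly towards [mu].  This enlarges the gap
    between p+2 and p+3, which is possible when the next gap, if any,
    is strictly larger; the beads p+1 and p+2 do move, as B is off [mu] there. *)
Lemma monotone_below_equal_gaps (R : realType) n (mu : R) (B : 'rV[R]_n.+1) p :
  monotone_beads mu B -> (p.+3 <= n.+1)%N ->
  profile mu B p.+3 - profile mu B p.+2 = profile mu B p.+1 - profile mu B p ->
  ((p.+3 < n.+1)%N -> profile mu B p.+3 - profile mu B p.+2 <
     profile mu B p.+4 - profile mu B p.+3) ->
  exists A, [/\ monotone_beads mu A, beads_le A B,
    profile mu A p.+3 = profile mu B p.+3,
    profile mu A p.+1 < profile mu B p.+1
  & profile mu A p.+2 < profile mu B p.+2].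
Proof.
move=> mB pn e last; set b := profile mu B.
have [b1 incB convB] := (monotone_beadsP mu B).1 mB.
have mu_le k : (k <= n.+1)%N -> mu <= b k.
  elim: k => // k IH kn; apply: le_trans (IH (ltnW kn)) _.
  exact: profile_increasing.
have mu_lt1 : mu < b p.+1.
  have := incB p ltac:(lia); have := incB p.+1 ltac:(lia).
  have := convB p ltac:(lia); have := mu_le p ltac:(lia).
  by rewrite -/b in e *; lra.
have mu_lt2 : mu < b p.+2 by apply: lt_trans mu_lt1 (incB _ _); lia.
(* Shrinking by the ratio 1 - r enlarges the gap after bead p+2 by
   r * (b p.+2 - mu). *)
have [r /andP[r0 r1] rgap] : exists2 r : R, 0 < r < 1 & (p.+3 < n.+1)%N ->
    r * (b p.+2 - mu) <= b p.+4 - b p.+3 - (b p.+3 - b p.+2).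
  have [lt|ge] := ltnP p.+3 n.+1; last first.
    by exists (1 / 2); [apply/andP; split; lra|lia].
  have := last lt; rewrite -/b => h.
  set x := b p.+2 - mu; set y := b p.+4 - b p.+3 - (b p.+3 - b p.+2).
  have x0 : 0 < x by rewrite /x; lra.
  have y0 : 0 < y by rewrite /y; lra.
  have xy0 : 0 < x + y by lra.
  exists (y / (x + y)) => [|_].
    by apply/andP; split; [rewrite divr_gt0 | rewrite ltr_pdivrMr //; lra].
  by rewrite mulrAC ler_pdivrMr // ler_wpM2l; lra.
pose f k := if (k <= p.+2)%N then b k - r * (b k - mu) else b k.
pose A := beads_of n f.
have f0 : f 0%N = mu by rewrite /f /= subrr mulr0 subr0.
have AE k : (k <= n.+1)%N -> profile mu A k = f k by exact: profile_beads_of.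
have fb k : (k <= n.+1)%N -> f k <= b k.
  move=> kn; rewrite /f; case: ifP => // _; rewrite gerBl mulr_ge0 ?(ltW r0) //.
  by rewrite subr_ge0 mu_le.
have scale (x y : R) : x <= y -> x - r * (x - mu) <= y - r * (y - mu).
  by move=> xy; have : 0 <= (1 - r) * (y - x); [apply: mulr_ge0; lra|lra].
exists A; split.
- apply/monotone_beadsP; split=> [|k kn|k kn]; rewrite !AE ?f0; try lia.
  + by rewrite /f ltn0Sn; have := scale _ _ b1; rewrite -/b; lra.
  + have bk : b k.+1 < b k.+2 by exact: incB.
    have [kp|kp] := leqP k.+2 p.+2.
      rewrite /f !ifT; try lia.
      by have : 0 < (1 - r) * (b k.+2 - b k.+1); [apply: mulr_gt0; lra|lra].
    by rewrite [f k.+2]/f leqNgt kp; apply: le_lt_trans (fb _ _) bk; lia.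
  + have cB : 2 * b k.+1 <= b k + b k.+2 by exact: convB.
    have [kp|kp|kp] := ltngtP k p.+1.
    * rewrite /f !ifT; try lia.
      by have : 0 <= (1 - r) * (b k + b k.+2 - 2 * b k.+1);
        [apply: mulr_ge0; lra|lra].
    * have [->|kp'] := eqVneq k p.+2.
        rewrite /f leqnn !ifF; try lia.
        by have := rgap ltac:(lia); lra.
      by rewrite /f !ifF; try lia.
    * rewrite kp in cB *; rewrite /f leqnn leqnSn ltnn.
      have := ler_wpM2l (ltW r0) (ltW (incB p ltac:(lia))); rewrite -/b.
      have : 0 < r * (b p.+2 - mu) by rewrite mulr_gt0 // subr_gt0.
      by lra.
- by move=> i; rewrite -!(profile_ord mu) AE // fb.
- by rewrite AE // /f ltnn.
- rewrite AE ?/f; last lia.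
  by rewrite leqnSn /= gtrBl mulr_gt0 // subr_gt0.
- rewrite AE ?/f; last lia.
  by rewrite leqnn /= gtrBl mulr_gt0 // subr_gt0.
Qed.

(** A triple of equal gaps starting as late as possible: a tie with the gap
    after it would give a later triple. *)
Lemma last_equal_gaps (R : realType) n (mu : R) (B : 'rV[R]_n.+1) j :
  let b := profile mu B in
  monotone_beads mu B -> (j.+3 <= n.+1)%N ->
  b j.+3 - b j.+2 = b j.+1 - b j ->
  exists p, [/\ (p.+3 <= n.+1)%N, b p.+3 - b p.+2 = b p.+1 - b p
    & (p.+3 < n.+1)%N -> b p.+3 - b p.+2 < b p.+4 - b p.+3].
Proof.
move=> b mB jn ej; have [_ _ convB] := (monotone_beadsP mu B).1 mB.
pose triple p := (p.+3 <= n.+1)%N && (b p.+3 - b p.+2 == b p.+1 - b p).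
have ex_triple : exists p, triple p by exists j; rewrite /triple jn ej eqxx.
have triple_bound p : triple p -> (p <= n)%N by case/andP; lia.
have [p /andP[pn /eqP ep] pmax] := ex_maxnP ex_triple triple_bound.
exists p; split=> // pn'; rewrite ltNge; apply/negP => le.
suff : triple p.+1 by move/pmax; rewrite ltnn.
rewrite /triple pn'; apply/eqP.
have := convB p ltac:(lia); have := convB p.+1 ltac:(lia).
by have := convB p.+2 ltac:(lia); rewrite -/b; lra.
Qed.

Theorem theorem2 (R : realType) (n : nat) (hn : (1 <= n)%N) (mu : R)
    (B : 'rV[R]_n) (hB : monotone_beads mu B) :
  (forall j k : 'I_n, k = j.+2 :> nat -> gap mu B j < gap mu B k) <->
  (forall A : 'rV[R]_n, monotone_beads mu A -> beads_lt A B ->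
     slides_to mu A B).
Proof.
case: n hn B hB => // n _ B hB; split=> [no_equal A mA [AB _]|slide j k kj].
  exact: slides_to_no_equal_gaps.
rewrite ltNge; apply/negP => le_gap.
have jn : (j.+3 <= n.+1)%N by have := ltn_ord k; lia.
have ej : profile mu B j.+3 - profile mu B j.+2 =
          profile mu B j.+1 - profile mu B j.
  have [_ _ convB] := (monotone_beadsP mu B).1 hB.
  have := convB j ltac:(lia); have := convB j.+1 ltac:(lia).
  by move: le_gap; rewrite !gap_profile kj; lra.
have [p [pn ep p_last]] := last_equal_gaps hB jn ej.
have [A [mA AB A3 A1 A2]] := monotone_below_equal_gaps hB pn ep p_last.
apply: (equal_gaps_block_slides pn ep hB A3 A1 A2); apply: slide => //.
by split=> // eAB; rewrite eAB ltxx in A1.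
Qed.
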